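(* Let $A\in\mathbb{H}^{m\times m}$ with $\operatorname{Ind}(A)=1$. Then the group inverse $A^{\#}$ of $A$ is given by $$A^{\#}=A^{(2)}_{l,(A,A)}=A^{(2)}_{r,(A,A)}.$$
   Context: $\mathbb{H}$ denotes the real quaternions. The rank of a quaternion matrix is the maximal number of right linearly independent columns (equivalently, of left linearly independent rows). For $A\in\mathbb{H}^{m\times m}$, $\operatorname{Ind}(A)$ is the smallest integer $k\ge 0$ with $\operatorname{rank}(A^{k+1})=\operatorname{rank}(A^k)$. When $\operatorname{Ind}(A)=1$, the group inverse $A^{\#}$ is the unique $X\in\mathbb{H}^{m\times m}$ with $A^{2}X=A$, $XAX=X$, $AX=XA$. For $B\in\mathbb{H}^{m\times n}$: $\mathcal{R}_r(B)=\{Bx : x\in\mathbb{H}^{n\times 1}\}$, $\mathcal{N}_r(B)=\{x\in\mathbb{H}^{n\times 1} : Bx=0\}$, $\mathcal{R}_l(B)=\{xB : x\in\mathbb{H}^{1\times m}\}$, $\mathcal{N}_l(B)=\{x\in\mathbb{H}^{1\times m} : xB=0\}$. $A^{(2)}_{r,(S,T)}$ denotes the matrix $X$ with $XAX=X$, $\mathcal{R}_r(X)=\mathcal{R}_r(S)$, $\mathcal{N}_r(X)=\mathcal{N}_r(T)$; $A^{(2)}_{l,(S,T)}$ denotes the matrix $X$ with $XAX=X$, $\mathcal{R}_l(X)=\mathcal{R}_l(S)$, $\mathcal{N}_l(X)=\mathcal{N}_l(T)$ (each is unique when it exists). *)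

(* Defs.v *)
From HB Require Import structures.
From mathcomp Require Import all_boot all_order all_algebra.
From mathcomp Require Import boolp classical_sets reals.
From mathcomp Require Import ring.

Set Implicit Arguments.
Unset Strict Implicit.
Unset Printing Implicit Defensive.

Import GRing.Theory.
Local Open Scope classical_set_scope.
Local Open Scope ring_scope.

(* Quat a b c d stands for a + b i + c j + d k, with i^2 = j^2 = k^2 = ijk = -1. *)
Record quat (R : Type) := Quat { qre : R; qi : R; qj : R; qk : R }.

Section QuaternionRing.
Variable R : comNzRingType.

Definition tuple_of_quat (x : quat R) : R * R * R * R :=
  (qre x, qi x, qj x, qk x).
Definition quat_of_tuple (t : R * R * R * R) : quat R :=
  Quat t.1.1.1 t.1.1.2 t.1.2 t.2.
Lemma tuple_of_quatK : cancel tuple_of_quat quat_of_tuple.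
Proof. by case. Qed.

HB.instance Definition _ := Choice.copy (quat R) (can_type tuple_of_quatK).

Definition addq (x y : quat R) : quat R :=
  Quat (qre x + qre y) (qi x + qi y) (qj x + qj y) (qk x + qk y).
Definition oppq (x : quat R) : quat R :=
  Quat (- qre x) (- qi x) (- qj x) (- qk x).
Definition mulq (x y : quat R) : quat R :=
  Quat (qre x * qre y - qi x * qi y - qj x * qj y - qk x * qk y)
       (qre x * qi y + qi x * qre y + qj x * qk y - qk x * qj y)
       (qre x * qj y - qi x * qk y + qj x * qre y + qk x * qi y)
       (qre x * qk y + qi x * qj y - qj x * qi y + qk x * qre y).
Definition zeroq : quat R := Quat 0 0 0 0.
Definition oneq : quat R := Quat 1 0 0 0.

Lemma addqA : associative addq.
Proof. by move=> x y z; rewrite /addq /= !addrA. Qed.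
Lemma addqC : commutative addq.
Proof. by move=> x y; congr Quat; exact: addrC. Qed.
Lemma add0q : left_id zeroq addq.
Proof. by case=> a b c d; rewrite /addq /= !add0r. Qed.
Lemma addNq : left_inverse zeroq oppq addq.
Proof. by move=> x; rewrite /addq /= !addNr. Qed.
HB.instance Definition _ :=
  GRing.isZmodule.Build (quat R) addqA addqC add0q addNq.

Lemma mulqA : associative mulq.
Proof. by move=> x y z; congr Quat => /=; ring. Qed.
Lemma mul1q : left_id oneq mulq.
Proof. by case=> a b c d; congr Quat => /=; ring. Qed.
Lemma mulq1 : right_id oneq mulq.
Proof. by case=> a b c d; congr Quat => /=; ring. Qed.
Lemma mulqDl : left_distributive mulq addq.
Proof. by move=> x y z; congr Quat => /=; ring. Qed.
Lemma mulqDr : right_distributive mulq addq.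
Proof. by move=> x y z; congr Quat => /=; ring. Qed.
Lemma oneq_neq0 : oneq != 0.
Proof. by apply/eqP => -[/eqP]; rewrite oner_eq0. Qed.
HB.instance Definition _ := GRing.Zmodule_isNzRing.Build (quat R)
  mulqA mul1q mulq1 mulqDl mulqDr oneq_neq0.

End QuaternionRing.

Section QuaternionMatrices.
Variable R : realType.
Local Notation H := (quat R).

Definition cols_right_indep m n (B : 'M[H]_(m, n)) (J : {set 'I_n}) : Prop :=
  forall c : 'I_n -> H,
    (forall i, \sum_(j in J) B i j * c j = 0) -> forall j, j \in J -> c j = 0.

Definition qrank m n (B : 'M[H]_(m, n)) : nat :=
  \max_(J : {set 'I_n} | `[< cols_right_indep B J >]) #|J|.

(* Ind(A) = k *)
Definition is_index m (A : 'M[H]_m) (k : nat) : Prop :=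
  qrank (A ^+ k.+1) = qrank (A ^+ k) /\
  forall j : nat, qrank (A ^+ j.+1) = qrank (A ^+ j) -> (k <= j)%N.

Definition right_range m n (B : 'M[H]_(m, n)) : set 'cV[H]_m :=
  [set B *m x | x in [set: 'cV[H]_n]].
Definition right_null m n (B : 'M[H]_(m, n)) : set 'cV[H]_n :=
  [set x | B *m x = 0].
Definition left_range m n (B : 'M[H]_(m, n)) : set 'rV[H]_n :=
  [set x *m B | x in [set: 'rV[H]_m]].
Definition left_null m n (B : 'M[H]_(m, n)) : set 'rV[H]_m :=
  [set x | x *m B = 0].

Definition is_group_inverse m (A X : 'M[H]_m) : Prop :=
  [/\ A ^+ 2 *m X = A, X *m A *m X = X & A *m X = X *m A].

Definition is_outer_inverse_r m n p q (A : 'M[H]_(m, n))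
    (S : 'M[H]_(n, p)) (T : 'M[H]_(q, m)) (X : 'M[H]_(n, m)) : Prop :=
  [/\ X *m A *m X = X, right_range X = right_range S
    & right_null X = right_null T].

Definition is_outer_inverse_l m n p q (A : 'M[H]_(m, n))
    (S : 'M[H]_(p, m)) (T : 'M[H]_(n, q)) (X : 'M[H]_(n, m)) : Prop :=
  [/\ X *m A *m X = X, left_range X = left_range S
    & left_null X = left_null T].

Lemma is_group_inverse_uniq m (A X Y : 'M[H]_m) :
  is_group_inverse A X -> is_group_inverse A Y -> X = Y.
Proof.
rewrite /is_group_inverse expr2 => -[X1 X2 X3] [Y1 Y2 Y3].
have XY : X *m A = Y *m A.
  have -> : X *m A = X *m (A *m A *m Y) by rewrite Y1.
  by rewrite !mulmxA -X3 -[A *m X *m A]mulmxA -X3 mulmxA X1 Y3.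
by rewrite -X2 XY -mulmxA X3 XY mulmxA -[Y *m Y *m A]mulmxA -Y3 mulmxA Y2.
Qed.

Lemma is_outer_inverse_r_uniq m n p q (A : 'M[H]_(m, n))
    (S : 'M[H]_(n, p)) (T : 'M[H]_(q, m)) (X Y : 'M[H]_(n, m)) :
  is_outer_inverse_r A S T X -> is_outer_inverse_r A S T Y -> X = Y.
Proof.
move=> [X1 X2 X3] [Y1 Y2 Y3].
have ext (B C : 'M[H]_(n, m)) : (forall v : 'cV_m, B *m v = C *m v) -> B = C.
  by move=> BC; apply/trmx_inj/row_matrixP => i; rewrite -!tr_col !colE BC.
transitivity (Y *m A *m X); apply: ext => v.
  have : right_range Y (X *m v) by rewrite Y2 -X2; exists v.
  by case=> w _ Yw; rewrite -mulmxA -Yw mulmxA Y1.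
have : right_null Y (v - A *m X *m v).
  by rewrite Y3 -X3 /right_null /= mulmxBr !mulmxA X1 subrr.
by rewrite /right_null /= mulmxBr !mulmxA => /subr0_eq.
Qed.

Lemma is_outer_inverse_l_uniq m n p q (A : 'M[H]_(m, n))
    (S : 'M[H]_(p, m)) (T : 'M[H]_(n, q)) (X Y : 'M[H]_(n, m)) :
  is_outer_inverse_l A S T X -> is_outer_inverse_l A S T Y -> X = Y.
Proof.
move=> [X1 X2 X3] [Y1 Y2 Y3].
have ext (B C : 'M[H]_(n, m)) : (forall v : 'rV_n, v *m B = v *m C) -> B = C.
  by move=> BC; apply/row_matrixP => i; rewrite !rowE BC.
transitivity (X *m A *m Y); apply: ext => v.
  have : left_range Y (v *m X) by rewrite Y2 -X2; exists v.
  by case=> w _ Yw; rewrite !mulmxA -Yw -!mulmxA [Y *m _]mulmxA Y1.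
have : left_null Y (v - v *m X *m A).
  by rewrite Y3 -X3 /left_null /= mulmxBl -!mulmxA [X *m _]mulmxA X1 subrr.
by rewrite /left_null /= mulmxBl !mulmxA => /subr0_eq.
Qed.

(* The value is 0 when no such matrix exists, so an equation between two of
   these is meaningful only together with the existence of both sides. *)
Definition group_inverse m (A : 'M[H]_m) : 'M[H]_m :=
  xget 0 [set X | is_group_inverse A X].
Definition outer_inverse_r m n p q (A : 'M[H]_(m, n))
    (S : 'M[H]_(n, p)) (T : 'M[H]_(q, m)) : 'M[H]_(n, m) :=
  xget 0 [set X | is_outer_inverse_r A S T X].
Definition outer_inverse_l m n p q (A : 'M[H]_(m, n))
    (S : 'M[H]_(p, m)) (T : 'M[H]_(n, q)) : 'M[H]_(n, m) :=
  xget 0 [set X | is_outer_inverse_l A S T X].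

End QuaternionMatrices.

(* Main.v *)
(* From [rank (A ^ 2) = rank A], factoring [A] through a maximal independent
   set of columns gives [A ^ 2 x = 0 -> A x = 0].  Since real
   scalars are central and the quaternion matrices form a finite-dimensional
   real space, [A] is annihilated by a nonzero real polynomial.  Its lowest
   power of [A] can be lowered to [A] itself, and then the relation reads
   [A = A ^ 2 Y] for a real polynomial [Y] in [A]: the group inverse is
   [A Y ^ 2], and it has the same ranges and null spaces as [A]. *)
Require Import Defs.
From mathcomp Require Import all_boot all_order all_algebra.
From mathcomp Require Import boolp classical_sets reals ring.

Set Implicit Arguments.
Unset Strict Implicit.
Unset Printing Implicit Defensive.

Import Order.TTheory GRing.Theory Num.Theory.
Local Open Scope classical_set_scope.
Local Open Scope ring_scope.

(** A matrix with one more row than columns has a nonzero left kernel vector, and its entries serve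
    as [c]. An arbitrary finite index [T] allows (row, column, coordinate) triples to be used
    directly. *)
Lemma lin_dep_finfun (F : fieldType) (T : finType)
    (v : 'I_#|T|.+1 -> T -> F) :
  exists2 c : 'I_#|T|.+1 -> F, exists i, c i != 0
    & forall t, \sum_i c i * v i t = 0.
Proof.
pose P : 'M[F]_(#|T|.+1, #|T|) := \matrix_(i, k) v i (enum_val k).
have /rowV0Pn[u /sub_kermxP uP /rV0Pn un0] : kermx P != 0.
  by rewrite kermx_eq0 neq_ltn ltnS rank_leq_col.
exists (u ord0) => // t.
move/rowP/(_ (enum_rank t)): uP; rewrite !mxE => uP.
by rewrite -[RHS]uP; apply: eq_bigr => i _; rewrite mxE enum_rankK.
Qed.

Section RealScalars.
Variable R : comNzRingType.

Definition realq (a : R) : quat R := Quat a 0 0 0.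

Lemma realq_comm (a : R) (x : quat R) : realq a * x = x * realq a.
Proof. by case: x => b c d e; congr Quat => /=; ring. Qed.

(** A left scalar cannot in general cross a matrix factor over a noncommutative ring; it does here
    because real scalars are central. *)
Lemma mulmx_realZ m n p (a : R) (B : 'M[quat R]_(m, n)) (C : 'M_(n, p)) :
  B *m (realq a *: C) = realq a *: (B *m C).
Proof.
apply/matrixP => i j; rewrite !mxE mulr_sumr; apply: eq_bigr => k _.
by rewrite mxE !mulrA realq_comm.
Qed.

Definition qcoord (l : 'I_4) (x : quat R) : R :=
  nth 0 [:: qre x; qi x; qj x; qk x] l.

Lemma qcoordD l : {morph qcoord l : x y / x + y}.
Proof. by move=> x y; case: l => -[|[|[|[|]]]]. Qed.

Lemma qcoord0 l : qcoord l 0 = 0.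
Proof. by case: l => -[|[|[|[|]]]]. Qed.

Lemma qcoordZ l (a : R) (x : quat R) : qcoord l (realq a * x) = a * qcoord l x.
Proof. by case: l => -[|[|[|[|//]]]] lt4; rewrite /qcoord /=; ring. Qed.

Lemma qcoord_inj (x y : quat R) : (forall l, qcoord l x = qcoord l y) -> x = y.
Proof.
case: x y => a b c d [a' b' c' d'] xy.
by congr Quat; [exact: (xy (@Ordinal 4 0 isT)) | exact: (xy (@Ordinal 4 1 isT))
  | exact: (xy (@Ordinal 4 2 isT)) | exact: (xy (@Ordinal 4 3 isT))].
Qed.

End RealScalars.

(** The inverse is the conjugate divided by the squared norm [n], a sum of squares that vanishes
    only when all four coordinates do. *)
Lemma quat_invr (F : realFieldType) (x : quat F) :
  x != 0 -> exists y, x * y = 1.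
Proof.
case: x => a b c d xn0; set n := a ^+ 2 + b ^+ 2 + c ^+ 2 + d ^+ 2.
have n0 : n != 0.
  apply: contra xn0; rewrite /n !paddr_eq0 ?addr_ge0 ?sqr_ge0 // !sqrf_eq0.
  by case/andP=> /andP[/andP[/eqP-> /eqP->] /eqP->] /eqP->.
exists (Quat (a / n) (- b / n) (- c / n) (- d / n)).
by congr Quat => /=; rewrite /n; field.
Qed.

(** The first 4m^2 + 1 powers of [A] lie in a space of dimension 4m^2 over [F], so they are linearly
    dependent. *)
Lemma real_annihilator (F : fieldType) m (A : 'M[quat F]_m) :
  exists N (c : 'I_N -> F),
    (exists i, c i != 0) /\ \sum_i realq (c i) *: A ^+ i = 0.
Proof.
have [c cn0 c0] := @lin_dep_finfun F ('I_m * 'I_m * 'I_4)%type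
  (fun i t => qcoord t.2 ((A ^+ i) t.1.1 t.1.2)).
exists _, c; split=> //; apply/matrixP => a b; apply: qcoord_inj => l.
rewrite summxE mxE qcoord0 (big_morph _ (@qcoordD _ l) (qcoord0 _ l)).
rewrite -[RHS](c0 (a, b, l)); apply: eq_bigr => i _.
by rewrite mxE qcoordZ.
Qed.

Section Rank.
Variable R : realType.
Local Notation H := (quat R).

Definition supported n (J : {set 'I_n}) (x : 'cV[H]_n) : Prop :=
  forall j, j \notin J -> x j 0 = 0.

Lemma mulmx_supported m n (B : 'M[H]_(m, n)) (J : {set 'I_n}) x :
  supported J x -> forall i, (B *m x) i 0 = \sum_(j in J) B i j * x j 0.
Proof.
move=> xJ i; rewrite mxE [LHS](bigID (mem J)) /= [X in _ + X]big1 ?addr0 //.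
by move=> j jJ; rewrite xJ // mulr0.
Qed.

(** Independence becomes triviality of a kernel on supported vectors, so that matrix algebra can
    replace sums over [J]. *)
Lemma cols_right_indepP m n (B : 'M[H]_(m, n)) (J : {set 'I_n}) :
  cols_right_indep B J <-> forall x, supported J x -> B *m x = 0 -> x = 0.
Proof.
split=> [BJ x xJ Bx | BJ c Bc j jJ].
  apply/colP => j; rewrite [RHS]mxE; have [jJ|/xJ//] := boolP (j \in J).
  by apply: (BJ (x ^~ 0)) => // i; rewrite -(mulmx_supported _ xJ) Bx mxE.
pose x : 'cV[H]_n := \col_j if j \in J then c j else 0.
have xJ : supported J x by move=> k kJ; rewrite mxE (negPf kJ).
have Bx : B *m x = 0.
  apply/colP => i; rewrite (mulmx_supported _ xJ) mxE -[RHS](Bc i).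
  by apply: eq_bigr => k kJ; rewrite mxE kJ.
by move/colP/(_ j): (BJ _ xJ Bx); rewrite !mxE jJ.
Qed.

Lemma qrank_witness m n (B : 'M[H]_(m, n)) :
  exists2 J, cols_right_indep B J & #|J| = qrank B.
Proof.
have P0 : (0 < #|[pred J : {set 'I_n} | `[< cols_right_indep B J >]]|)%N.
  (* The empty set is independent, so the maximum defining the rank is attained. *)
  apply/card_gt0P; exists finset.set0; rewrite inE => c _ j.
  by rewrite inE.
have [J /= JB eqJ] := eq_bigmax_cond (fun J : {set 'I_n} => #|J|) P0.
by exists J => //; apply/asboolP.
Qed.

Lemma leq_qrank m n (B : 'M[H]_(m, n)) J :
  cols_right_indep B J -> (#|J| <= qrank B)%N.
Proof.
move=> /asboolP BJ.
exact: (@leq_bigmax_cond _ _ (fun J : {set 'I_n} => #|J|) J BJ).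
Qed.

(** For [k] outside [J], maximality yields a relation [x] on [k |: J]; its entry at [k] is nonzero,
    since otherwise [J] would be dependent. *)
Lemma col_of_max_indep m n (B : 'M[H]_(m, n)) J k :
  cols_right_indep B J -> #|J| = qrank B ->
  exists2 y, supported J y & B *m y = col k B.
Proof.
move=> BJ cardJ; have [kJ | kJ] := boolP (k \in J).
  exists (delta_mx k 0); last by rewrite colE.
  by move=> j jJ; rewrite mxE; case: eqP jJ => [->|//]; rewrite kJ.
have /cols_right_indepP : ~ cols_right_indep B (k |: J).
  by move/leq_qrank; rewrite cardsU1 kJ -cardJ ltnn.
move/existsNP => [x /not_implyP[xkJ /not_implyP[Bx /eqP xn0]]].
have xk0 : x k 0 != 0.
  apply: contra xn0 => /eqP xk0; apply/eqP.
  move/cols_right_indepP: BJ; apply=> // j jJ.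
  have [-> //|jk] := eqVneq j k.
  by apply: xkJ; rewrite !inE negb_or jk.
have [z xz] := quat_invr xk0.
(* Right scaling by [z] turns the entry of [x] at [k] into 1, so the subtraction clears that entry,
   while [B *m x = 0] leaves column [k] as the image. *)
exists (delta_mx k 0 - x *m z%:M).
  move=> j jJ; rewrite !mxE big_ord1 mxE eqxx mulr1n andbT.
  have [->|jk] := eqVneq j k; first by rewrite xz subrr.
  by rewrite xkJ ?mul0r ?subrr // !inE negb_or jk.
by rewrite mulmxBr mulmxA Bx mul0mx subr0 colE.
Qed.

(** A maximal independent set [J] for [A ^+ 2] is also independent for [A], and maximal there by
    equality of ranks. Hence [A = A *m C] with the columns of [C] supported on [J]. If
    [A *m (A *m B) = 0], then [A *m A] kills [C *m B], whose columns are supported on [J], so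
    [C *m B = 0]. *)
Lemma qrank_sqr_ker m (A : 'M[H]_m) : qrank (A ^+ 2) = qrank A ->
  forall p (B : 'M[H]_(m, p)), A *m (A *m B) = 0 -> A *m B = 0.
Proof.
rewrite expr2 => rkA p B.
have [J AAJ cardJ] := qrank_witness (A *m A).
have /cols_right_indepP AAJ' := AAJ.
have AJ : cols_right_indep A J.
  by apply/cols_right_indepP => x xJ Ax; apply: AAJ'; rewrite // -mulmxA Ax mulmx0.
have /choice[y yP] k : exists y, supported J y /\ A *m y = col k A.
  have [|y yJ Ay] := @col_of_max_indep _ _ A J k AJ; last by exists y.
  by rewrite cardJ.
pose C : 'M[H]_m := \matrix_(i, k) y k i 0.
have colC k : col k C = y k by apply/colP => i; rewrite !mxE.
have AC : A *m C = A.
  apply/matrixP => i k; have [_ /colP/(_ i)] := yP k.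
  by rewrite -colC !colE mulmxA -!colE !mxE.
move=> AAB; suff CB : C *m B = 0 by rewrite -AC -mulmxA CB mulmx0.
apply/matrixP => i k.
suff : col k (C *m B) = 0 by move/colP/(_ i); rewrite !mxE.
apply: AAJ'.
  move=> j jJ; rewrite !mxE big1 // => l _.
  by rewrite mxE (yP l).1 // mul0r.
by rewrite colE !mulmxA -colE -[A *m A *m C]mulmxA AC -mulmxA AAB col0.
Qed.

End Rank.

Section GroupInverse.
Variable R : realType.
Local Notation H := (quat R).

Lemma factor_through_sqr m (A : 'M[H]_m) :
  (forall B : 'M[H]_m, A *m (A *m B) = 0 -> A *m B = 0) ->
  exists2 Y, A *m Y = Y *m A & A *m A *m Y = A.
Proof.
move=> kerA; have [N [c [[i0 ci0] c0]]] := real_annihilator A.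
case: (@arg_minnP _ i0 (fun i => c i != 0) val ci0) => i ci imin.
(* As [i] is the least index with a nonzero coefficient, the annihilating polynomial is [A ^+ i]
   times [c i + A *m S]. *)
pose S : 'M[H]_m := \sum_(j < N | (i < j)%N) realq (c j) *: A ^+ (j - i.+1).
have commS : A *m S = S *m A.
  rewrite !mulmxE mulr_sumr mulr_suml; apply: eq_bigr => j _.
  by rewrite -mulmxE mulmx_realZ -scalemxAl mulmxE -exprS -exprSr.
have kerX k (B : 'M[H]_m) : A ^+ k *m B = 0 -> A *m B = 0.
  elim: k B => [|k IH] B; first by rewrite expr0 mul1mx => ->; rewrite mulmx0.
  by rewrite exprSr -mulmxE -mulmxA => /IH /kerA.
have AcS : A *m (realq (c i) *: 1%:M + A *m S) = 0.
  apply: (kerX i); rewrite -[RHS]c0 (bigD1 i) //= mulmxDr mulmx_realZ mulmx1.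
  congr (_ + _).
  (* Indices below [i] contribute nothing, by minimality. *)
  rewrite (bigID (fun j : 'I_N => (i < j)%N)) /= [X in _ + X]big1 ?addr0; last first.
    move=> j /andP[ji]; rewrite -leqNgt => leji.
    have [->|/imin] := eqVneq (c j) 0; first by rewrite scale0r.
    by move=> leij; case/eqP: ji; apply/val_inj/eqP; rewrite eqn_leq leji.
  rewrite !mulmxE !mulr_sumr; apply: eq_big => j.
    by rewrite -val_eqE; case: ltnP => [/gtn_eqF->|_]; rewrite ?andbF.
  move=> ij; rewrite -!mulmxE !mulmx_realZ !mulmxE -exprS -exprD.
  by rewrite -subSn // subSS subnKC // ltnW.
(* [AcS] reads [A *m A *m S = - c i A], which fixes the scalar. *)
exists (realq (- (c i)^-1) *: S).
  by rewrite mulmx_realZ -scalemxAl commS.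
rewrite mulmx_realZ -mulmxA.
move: AcS; rewrite mulmxDr mulmx_realZ mulmx1 addrC => /addr0_eq AAS.
rewrite -[A *m (A *m S)]opprK AAS scalerN -scaleNr scalerA.
rewrite (_ : - realq _ * _ = 1) ?scale1r //.
by congr Quat => /=; field.
Qed.

(** Both products of [A] with [A *m Y *m Y] collapse to [A *m Y], and the three equations follow. *)
Lemma group_inverse_of_factor m (A Y : 'M[H]_m) :
  A *m Y = Y *m A -> A *m A *m Y = A -> is_group_inverse A (A *m Y *m Y).
Proof.
move=> AY AAY; have AX : A *m (A *m Y *m Y) = A *m Y by rewrite !mulmxA AAY.
have XA : A *m Y *m Y *m A = A *m Y.
  by rewrite -mulmxA -AY mulmxA -(mulmxA A Y) -AY mulmxA AAY.
rewrite /is_group_inverse expr2 -mulmxE AX XA; split=> //.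
  by rewrite -mulmxA AX mulmxA AAY.
by rewrite !mulmxA -(mulmxA A Y) -AY mulmxA AAY.
Qed.

(** From [X = A X^2 = X^2 A] and [A = X A^2 = A^2 X], each matrix is a left and a right multiple of
    the other: right multiples compare ranges, left multiples compare null spaces. *)
Lemma group_inverse_outer_r m (A X : 'M[H]_m) :
  is_group_inverse A X -> is_outer_inverse_r A A A X.
Proof.
rewrite /is_group_inverse expr2 => -[AAX XAX AX].
have AXX : A *m X *m X = X by rewrite AX.
have XAA : X *m A *m A = A by rewrite -AX -mulmxA -AX mulmxA.
have XXA : X *m X *m A = X by rewrite -mulmxA -AX mulmxA.
split=> //; apply/seteqP; split=> v; rewrite /right_null /=.
- by case=> w _ <-; exists (X *m X *m w); rewrite // !mulmxA AXX.
- by case=> w _ <-; exists (A *m A *m w); rewrite // !mulmxA XAA.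
- by move=> Xv; rewrite -AAX -mulmxA Xv mulmx0.
- by move=> Av; rewrite -XXA -mulmxA Av mulmx0.
Qed.

(** The same factorizations with the two sides exchanged. *)
Lemma group_inverse_outer_l m (A X : 'M[H]_m) :
  is_group_inverse A X -> is_outer_inverse_l A A A X.
Proof.
rewrite /is_group_inverse expr2 => -[AAX XAX AX].
have AXX : A *m X *m X = X by rewrite AX.
have XAA : X *m A *m A = A by rewrite -AX -mulmxA -AX mulmxA.
have XXA : X *m X *m A = X by rewrite -mulmxA -AX mulmxA.
split=> //; apply/seteqP; split=> v; rewrite /left_null /=.
- by case=> w _ <-; exists (w *m (X *m X)); rewrite // -mulmxA XXA.
- by case=> w _ <-; exists (w *m (A *m A)); rewrite // -mulmxA AAX.
- by move=> vX; rewrite -XAA !mulmxA vX !mul0mx.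
- by move=> vA; rewrite -AXX !mulmxA vA !mul0mx.
Qed.

End GroupInverse.

Theorem corollary4p8 (R : realType) (m : nat) (A : 'M[quat R]_m) :
  is_index A 1 ->
  [/\ is_group_inverse A (group_inverse A),
      is_outer_inverse_l A A A (outer_inverse_l A A A),
      is_outer_inverse_r A A A (outer_inverse_r A A A),
      group_inverse A = outer_inverse_l A A A
    & outer_inverse_l A A A = outer_inverse_r A A A].
Proof.
case=> rkA _; rewrite expr1 in rkA.
have [Y AY AAY] := factor_through_sqr (qrank_sqr_ker rkA (p := m)).
have Xg := group_inverse_of_factor AY AAY; set X := A *m Y *m Y in Xg.
have Xl := group_inverse_outer_l Xg; have Xr := group_inverse_outer_r Xg.
(* Since [X] meets all three specifications, none of the [xget] choices falls back on the default
   0. *)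
have Gg : is_group_inverse A (group_inverse A) by apply: (xgetI 0 Xg).
have Gl : is_outer_inverse_l A A A (outer_inverse_l A A A) by apply: (xgetI 0 Xl).
have Gr : is_outer_inverse_r A A A (outer_inverse_r A A A) by apply: (xgetI 0 Xr).
split=> //.
  by rewrite (is_group_inverse_uniq Gg Xg) (is_outer_inverse_l_uniq Gl Xl).
by rewrite (is_outer_inverse_l_uniq Gl Xl) (is_outer_inverse_r_uniq Gr Xr).
Qed.
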